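(* Let $a<b$ be real and suppose that $f:[a,b]\to\mathbb{R}$ is differentiable on $[a,b]$ (with one-sided derivatives at the endpoints), that $f'$ is increasing, and that $f'\ge\lambda>0$ on $[a,b]$. Let $I=\int_a^b e^{if(x)}\,dx$ and let $\theta\in\mathbb{R}$ be such that $I=|I|e^{i\theta}$. Then $$ |I|=\left|\int_a^b e^{if(x)}\,dx\right|\le\frac{1+\sin(\theta-f(a))}{\lambda}\le\frac{2}{\lambda}. $$
   Context: Increasing is understood in the weak (non-strict) sense. *)

(* Defs.v *)
(* Stdlib reals with Coquelicot. *)
From Stdlib Require Import Reals.
From Coquelicot Require Import Coquelicot.
Open Scope R_scope.

(* e^(x + iy) = e^x (cos y + i sin y); Coquelicot has no complex exponential. *)
Definition Cexp (z : C) : C :=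
  (exp (Re z) * cos (Im z), exp (Re z) * sin (Im z)).

Lemma Cexp_RtoC (x : R) : Cexp (RtoC x) = RtoC (exp x).
Proof.
  unfold Cexp, RtoC; simpl; rewrite cos_0, sin_0; f_equal; ring.
Qed.

Lemma Cexp_plus (z w : C) : Cexp (z + w)%C = (Cexp z * Cexp w)%C.
Proof.
  destruct z as [x y], w as [u v]; unfold Cexp, Cmult, Cplus; simpl.
  rewrite exp_plus, cos_plus, sin_plus; f_equal; ring.
Qed.

Lemma Cexp_Ci (t : R) : Cexp (Ci * RtoC t)%C = (cos t, sin t).
Proof.
  unfold Cexp, Ci, RtoC, Cmult; simpl.
  replace (0 * t - 1 * 0) with 0 by ring.
  replace (0 * 0 + 1 * t) with t by ring.
  rewrite exp_0; f_equal; ring.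
Qed.

Definition cc (a b : R) : R -> Prop := fun x => a <= x <= b.

(* The limit of difference quotients in [D_in] runs over points of [a,b] only,
   so the derivative is one-sided at a and at b. *)
Definition is_derivative_on (f f' : R -> R) (a b : R) : Prop :=
  forall x : R, cc a b x -> D_in f f' (cc a b) x.

Definition increasing_on (g : R -> R) (a b : R) : Prop :=
  forall x y : R, cc a b x -> cc a b y -> x <= y -> g x <= g y.

(* The instance is explicit because canonical inference on C only finds
   the structure over the field C, not the one over R. *)
Definition CRInt (g : R -> C) (a b : R) : C :=
  RInt (V := C_R_CompleteNormedModule) g a b.

(* Main.v *)
Require Import Defs.
From Stdlib Require Import Reals Lra.
From Coquelicot Require Import Coquelicot.
Open Scope R_scope.

(** Since [I = |I| e^(i theta)], one has [|I| = int_a^b cos g] with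
    [g = f - theta].  Formally, the function
    [Phi x = int_a^x cos g + (1 - sin (g x)) / f' x] has differential
    [(1 - sin g) d(1 / f') <= 0], whence
    [int_a^b cos g <= Phi b <= Phi a <= (1 - sin (g a)) / lambda].
    As [f'] need not be differentiable, the monotonicity of [Phi] is replaced by
    the increment bound
    [Phi y - Phi x <= (y - x) (f' y - f' x) / lambda] for [x <= y], whose sum over
    a uniform partition into [n] pieces is [O(1/n)] by telescoping. *)

Lemma le_of_increment_bound (Phi m : R -> R) (a b K : R) :
  a <= b -> 0 <= K -> increasing_on m a b ->
  (forall x y : R, a <= x -> x <= y -> y <= b ->
     Phi y - Phi x <= K * ((y - x) * (m y - m x))) ->
  Phi b <= Phi a.
Proof.
  intros hab hK hm hstep.
  assert (hn : forall n : nat, (0 < n)%nat ->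
    Phi b - Phi a <= K * ((b - a) * (m b - m a)) * / INR n).
  { intros n hn.
    assert (hN : 0 < INR n) by now apply lt_0_INR.
    set (h := (b - a) / INR n).
    assert (hh : 0 <= h) by (apply Rdiv_le_0_compat; lra).
    assert (hnh : INR n * h = b - a) by (unfold h; field; lra).
    (* All pieces have the same length [h], so in the sum of the first [k] increment bounds [h]
       factors out and the differences of [m] telescope. *)
    assert (hk : forall k : nat, (k <= n)%nat ->
      Phi (a + INR k * h) - Phi a <= K * (h * (m (a + INR k * h) - m a))).
    { induction k as [|k IHk]; intros hkn.
      - simpl; rewrite Rmult_0_l, Rplus_0_r; lra.
      - assert (hle : INR (S k) * h <= INR n * h)
          by (apply Rmult_le_compat_r; [lra | now apply le_INR]).
        assert (h0 : 0 <= INR k * h)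
          by (apply Rmult_le_pos; [apply pos_INR | lra]).
        rewrite S_INR in *.
        specialize (IHk (Nat.le_trans _ _ _ (Nat.le_succ_diag_r k) hkn)).
        pose proof (hstep (a + INR k * h) (a + (INR k + 1) * h)
          ltac:(lra) ltac:(lra) ltac:(lra)) as hs.
        replace (a + (INR k + 1) * h - (a + INR k * h)) with h in hs by ring.
        rewrite <- Rmult_assoc in *; lra. }
    specialize (hk n (Nat.le_refl n)).
    rewrite hnh in hk; replace (a + (b - a)) with b in hk by ring.
    replace (K * ((b - a) * (m b - m a)) * / INR n)
      with (K * (h * (m b - m a))) by (unfold h; field; lra).
    exact hk. }
  set (M := K * ((b - a) * (m b - m a))) in *.
  assert (hM : 0 <= M).
  { apply Rmult_le_pos; [exact hK|]; apply Rmult_le_pos; [lra|].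
    pose proof (hm a b (conj (Rle_refl a) hab) (conj hab (Rle_refl b)) hab); lra. }
  destruct (Rle_or_lt (Phi b) (Phi a)) as [hle|hlt]; [exact hle|exfalso].
  (* If [Phi b - Phi a] were positive, a large [n] would make [M / n] smaller than it. The divisor
     is [M + 1] because [M] may be zero. *)
  destruct (archimed_cor1 ((Phi b - Phi a) / (M + 1))) as [n [hn1 hn2]];
    [apply Rdiv_lt_0_compat; lra|].
  specialize (hn n hn2).
  assert (hN : 0 < / INR n) by (apply Rinv_0_lt_compat; now apply lt_0_INR).
  apply (Rmult_lt_compat_r (M + 1)) in hn1; [|lra].
  unfold Rdiv in hn1; rewrite Rmult_assoc, Rinv_l in hn1; lra.
Qed.

(** Freezing the weight at [1 / m x] makes it a constant, so [m] is never differentiated. The left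
    side is then the increment over [[x, y]] of [int_x^t cos g - sin (g t) / m x], whose derivative
    in [t] is [cos (g t) * (1 - m t / m x)], and the mean value theorem applies. *)
Lemma RInt_cos_increment (g m : R -> R) (a b lambda : R) :
  (forall x : R, continuous g x) ->
  (forall x : R, a < x < b -> is_derive g x (m x)) ->
  increasing_on m a b -> 0 < lambda ->
  (forall x : R, cc a b x -> lambda <= m x) ->
  forall x y : R, a <= x -> x <= y -> y <= b ->
  RInt (fun t => cos (g t)) x y + (sin (g x) - sin (g y)) / m x
    <= / lambda * ((y - x) * (m y - m x)).
Proof.
  intros hc hd hm hl hlow x y hax hxy hyb.
  assert (hcos : forall t : R, continuous (fun t => cos (g t)) t)
    by (intros t; exact (continuous_cos_comp g t (hc t))).
  assert (hex : forall u v : R, ex_RInt (fun t => cos (g t)) u v)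
    by (intros u v; apply (ex_RInt_continuous (V := R_CompleteNormedModule));
        intros t _; apply hcos).
  assert (hDI : forall t : R,
    is_derive (fun t => RInt (fun s => cos (g s)) x t) t (cos (g t))).
  { intros t; apply (is_derive_RInt (fun t => cos (g t)) _ x); [|apply hcos].
    apply filter_forall; intros u.
    apply (RInt_correct (V := R_CompleteNormedModule)), hex. }
  assert (hmx : lambda <= m x) by (apply hlow; split; lra).
  destruct (MVT_gen
    (fun t => RInt (fun s => cos (g s)) x t - sin (g t) / m x) x y
    (fun t => cos (g t) * (1 - m t / m x))) as [c [hcI hcE]].
  - rewrite Rmin_left, Rmax_right by lra; intros t ht.
    assert (hdt : is_derive g t (m t)) by (apply hd; lra).
    assert (hsin : is_derive (fun t => sin (g t)) t (m t * cos (g t)))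
      by (apply is_derive_comp with (f := sin) (g := g);
          [apply is_derive_sin | exact hdt]).
    replace (cos (g t) * (1 - m t / m x))
      with (cos (g t) - m t * cos (g t) * / m x) by (field; lra).
    apply @is_derive_minus; [apply hDI|].
    apply is_derive_ext with (f := fun t => scal (/ m x) (sin (g t))).
    + intros u; unfold scal; simpl; unfold mult; simpl; unfold Rdiv; ring.
    + rewrite Rmult_comm; apply @is_derive_scal; exact hsin.
  - intros t _; apply continuity_pt_filterlim.
    apply (continuous_minus (V := R_NormedModule)
      (fun t => RInt (fun s => cos (g s)) x t) (fun t => sin (g t) / m x)).
    + apply @ex_derive_continuous; eexists; apply hDI.
    + apply (continuous_mult (K := R_AbsRing) (fun t => sin (g t)) (fun _ => / m x)); [|apply continuous_const].
      exact (continuous_sin_comp g t (hc t)).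
  - rewrite Rmin_left, Rmax_right in hcI by lra.
    rewrite RInt_point in hcE; unfold zero in hcE; simpl in hcE.
    assert (hxc : m x <= m c) by (apply hm; unfold cc; lra).
    assert (hcy : m c <= m y) by (apply hm; unfold cc; lra).
    (* The left side is [- cos (g c) * (m c - m x) / m x]. Here [- cos (g c) <= 1],
       [0 <= m c - m x <= m y - m x] and [lambda <= m x]. *)
    assert (hdf : cos (g c) * (1 - m c / m x) <= / lambda * (m y - m x)).
    { replace (cos (g c) * (1 - m c / m x))
        with (/ m x * (- cos (g c) * (m c - m x))) by (field; lra).
      pose proof (COS_bound (g c)).
      apply Rle_trans with (/ m x * (m y - m x)).
      - apply Rmult_le_compat_l; [left; apply Rinv_0_lt_compat; lra | nra].
      - apply Rmult_le_compat_r; [lra | apply Rinv_le_contravar; lra]. }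
    apply (Rmult_le_compat_r (y - x)) in hdf; [|lra].
    unfold Rdiv in *; lra.
Qed.

(** [Phi b] exceeds the integral by [(1 - sin (g b)) / m b >= 0], while the integral in [Phi a]
    vanishes, so [Phi b <= Phi a] suffices. *)
Lemma RInt_cos_le (g m : R -> R) (a b lambda : R) :
  a < b ->
  (forall x : R, continuous g x) ->
  (forall x : R, a < x < b -> is_derive g x (m x)) ->
  increasing_on m a b -> 0 < lambda ->
  (forall x : R, cc a b x -> lambda <= m x) ->
  RInt (fun t => cos (g t)) a b <= (1 - sin (g a)) / lambda.
Proof.
  intros hab hc hd hm hl hlow.
  assert (hex : forall u v : R, ex_RInt (fun t => cos (g t)) u v).
  { intros u v; apply (ex_RInt_continuous (V := R_CompleteNormedModule)).
    intros t _; exact (continuous_cos_comp g t (hc t)). }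
  set (Phi := fun x => RInt (fun t => cos (g t)) a x + (1 - sin (g x)) / m x).
  assert (hPhi : Phi b <= Phi a).
  { apply (le_of_increment_bound Phi m a b (/ lambda)); [lra| |exact hm|].
    - left; now apply Rinv_0_lt_compat.
    - intros x y hax hxy hyb.
      pose proof (RInt_cos_increment g m a b lambda hc hd hm hl hlow
        x y hax hxy hyb) as hi.
      pose proof (RInt_Chasles (fun t => cos (g t)) a x y (hex a x) (hex x y))
        as hch; unfold plus in hch; simpl in hch.
      assert (hmx : lambda <= m x) by (apply hlow; split; lra).
      assert (hxy' : m x <= m y) by (apply hm; unfold cc; lra).
      (* Replaces the weight at [y] by the one frozen at [x]. The summand 1 in [Phi] serves this
         step: it makes the numerator nonnegative, so a larger [m] gives a smaller quotient. *)
      assert (hy : (1 - sin (g y)) / m y <= (1 - sin (g y)) / m x).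
      { apply Rmult_le_compat_l; [pose proof (SIN_bound (g y)); lra|].
        apply Rinv_le_contravar; lra. }
      unfold Phi, Rdiv in *; lra. }
  assert (hma : lambda <= m a) by (apply hlow; split; lra).
  assert (hmb : lambda <= m b) by (apply hlow; split; lra).
  assert (ha : (1 - sin (g a)) / m a <= (1 - sin (g a)) / lambda).
  { apply Rmult_le_compat_l; [pose proof (SIN_bound (g a)); lra|].
    apply Rinv_le_contravar; lra. }
  assert (hb : 0 <= (1 - sin (g b)) / m b)
    by (apply Rdiv_le_0_compat; [pose proof (SIN_bound (g b))|]; lra).
  unfold Phi in hPhi; rewrite RInt_point in hPhi.
  unfold zero in hPhi; simpl in hPhi; lra.
Qed.

(* Coquelicot's continuity is two-sided, so [f] is replaced by [f o clamp],
   which is constant outside [a,b] and hence continuous on all of R. *)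
Definition clamp (a b x : R) : R := Rmax a (Rmin b x).

Lemma clamp_in (a b x : R) : a <= b -> cc a b (clamp a b x).
Proof.
  intros hab; unfold cc, clamp, Rmax, Rmin; repeat destruct Rle_dec; lra.
Qed.

Lemma clamp_id (a b x : R) : cc a b x -> clamp a b x = x.
Proof.
  unfold cc, clamp, Rmax, Rmin; intros hx; repeat destruct Rle_dec; lra.
Qed.

Lemma clamp_dist (a b x y : R) :
  a <= b -> Rabs (clamp a b y - clamp a b x) <= Rabs (y - x).
Proof.
  intros hab; unfold clamp, Rmax, Rmin, Rabs.
  repeat destruct Rle_dec; repeat destruct Rcase_abs; lra.
Qed.

Lemma clamp_continuous (f f' : R -> R) (a b : R) :
  a <= b -> is_derivative_on f f' a b ->
  forall x : R, continuous (fun t => f (clamp a b t)) x.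
Proof.
  intros hab hf x; apply continuity_pt_filterlim; intros eps heps.
  pose proof (clamp_in a b x hab) as hx.
  destruct (cont_deriv _ _ _ _ (hf _ hx) eps heps) as [del [hdel H]].
  exists del; split; [exact hdel|].
  simpl in *; unfold Rdist in *; intros y [_ hy].
  (* The limit behind [cont_deriv] excludes the base point itself, and [clamp] may send distinct
     points to the same one. *)
  destruct (Req_dec (clamp a b y) (clamp a b x)) as [e|n].
  - rewrite e, Rminus_diag, Rabs_R0; exact heps.
  - apply H; split.
    + split; [now apply clamp_in | now apply not_eq_sym].
    + pose proof (clamp_dist a b x y hab); lra.
Qed.

Lemma clamp_is_derive (f f' : R -> R) (a b : R) :
  is_derivative_on f f' a b ->
  forall x : R, a < x < b -> is_derive (fun t => f (clamp a b t)) x (f' x).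
Proof.
  intros hf x hx; apply is_derive_Reals; intros eps heps.
  assert (hcx : cc a b x) by (unfold cc; lra).
  destruct (hf x hcx eps heps) as [del [hdel H]].
  (* The distances to both endpoints keep [x + h] inside [[a,b]], where [clamp] is the identity and
     the relative derivative gives the estimate. *)
  assert (hr : 0 < Rmin del (Rmin (x - a) (b - x)))
    by (repeat apply Rmin_glb_lt; lra).
  exists (mkposreal _ hr); simpl; intros h hh0 hh.
  apply Rmin_Rgt in hh as [h1 h2]; apply Rmin_Rgt in h2 as [h2 h3].
  assert (hch : cc a b (x + h))
    by (unfold cc; revert h2 h3; unfold Rabs; destruct Rcase_abs; lra).
  rewrite (clamp_id a b x hcx), (clamp_id a b (x + h) hch).
  simpl in H; unfold Rdist in H.
  specialize (H (x + h)).
  replace (x + h - x) with h in H by ring.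
  apply H; split; [split; [exact hch | lra] | lra].
Qed.

Lemma CRInt_Cexp_Ci (f : R -> R) (a b : R) :
  ex_RInt (fun t => cos (f t)) a b -> ex_RInt (fun t => sin (f t)) a b ->
  CRInt (fun t => Cexp (Ci * RtoC (f t))%C) a b
    = (RInt (fun t => cos (f t)) a b, RInt (fun t => sin (f t)) a b).
Proof.
  intros hc hs; apply (is_RInt_unique (V := C_R_CompleteNormedModule)).
  apply (is_RInt_ext (V := C_R_NormedModule)
    (fun t => (cos (f t), sin (f t)) : C)).
  - intros t _; symmetry; apply Cexp_Ci.
  - apply (is_RInt_fct_extend_pair (U := R_NormedModule) (V := R_NormedModule));
      simpl; now apply (RInt_correct (V := R_CompleteNormedModule)).
Qed.

(** Multiply by [e^(-i theta)] and take real parts. *)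
Lemma modulus_eq_of_polar (z : C) (r theta : R) :
  z = (RtoC r * Cexp (Ci * RtoC theta))%C ->
  r = cos theta * Re z + sin theta * Im z.
Proof.
  intros ->; rewrite Cexp_Ci; simpl.
  pose proof (sin2_cos2 theta) as h; unfold Rsqr in h.
  transitivity (r * (sin theta * sin theta + cos theta * cos theta));
    [rewrite h|]; ring.
Qed.

Theorem corollary5
    (a b : R) (hab : a < b)
    (f f' : R -> R) (hf : is_derivative_on f f' a b)
    (hmono : increasing_on f' a b)
    (lambda : R) (hlambda : 0 < lambda)
    (hlow : forall x : R, cc a b x -> lambda <= f' x)
    (I : C) (hI : I = CRInt (fun x : R => Cexp (Ci * RtoC (f x))%C) a b)
    (theta : R) (htheta : I = (RtoC (Cmod I) * Cexp (Ci * RtoC theta))%C) :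
  Cmod I = Cmod (CRInt (fun x : R => Cexp (Ci * RtoC (f x))%C) a b) /\
  Cmod (CRInt (fun x : R => Cexp (Ci * RtoC (f x))%C) a b)
    <= (1 + sin (theta - f a)) / lambda /\
  (1 + sin (theta - f a)) / lambda <= 2 / lambda.
Proof.
  rewrite <- hI; split; [reflexivity|split].
  2: { apply Rmult_le_compat_r; [left; now apply Rinv_0_lt_compat|].
       pose proof (SIN_bound (theta - f a)); lra. }
  set (F := fun t => f (clamp a b t)).
  assert (hab' : a <= b) by lra.
  assert (hFc : forall x : R, continuous F x)
    by exact (clamp_continuous f f' a b hab' hf).
  assert (hFf : forall x : R, Rmin a b < x < Rmax a b -> F x = f x).
  { rewrite Rmin_left, Rmax_right by lra; intros x hx.
    unfold F; rewrite clamp_id; [reflexivity | unfold cc; lra]. }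
  assert (hcos : ex_RInt (fun t => cos (F t)) a b).
  { apply (ex_RInt_continuous (V := R_CompleteNormedModule)).
    intros t _; exact (continuous_cos_comp F t (hFc t)). }
  assert (hsin : ex_RInt (fun t => sin (F t)) a b).
  { apply (ex_RInt_continuous (V := R_CompleteNormedModule)).
    intros t _; exact (continuous_sin_comp F t (hFc t)). }
  (* [f] and [F] agree on the open interval, which is enough for equal integrals. *)
  assert (hIF : I = (RInt (fun t => cos (F t)) a b, RInt (fun t => sin (F t)) a b)).
  { rewrite hI, <- CRInt_Cexp_Ci by assumption; symmetry.
    apply (RInt_ext (V := C_R_CompleteNormedModule)).
    intros x hx; now rewrite hFf. }
  pose proof (modulus_eq_of_polar I (Cmod I) theta htheta) as hmod.
  rewrite hIF in hmod at 2 3; simpl in hmod.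
  (* By the subtraction formula for the cosine, this integral is the real part of [e^(-i theta) I],
     which [hmod] identifies with [Cmod I]. *)
  assert (hint : RInt (fun t => cos (F t - theta)) a b = Cmod I).
  { rewrite hmod; apply (is_RInt_unique (V := R_CompleteNormedModule)).
    apply (is_RInt_ext (V := R_NormedModule)
      (fun t => plus (scal (cos theta) (cos (F t))) (scal (sin theta) (sin (F t))))).
    - intros t _; rewrite cos_minus.
      unfold plus, scal; simpl; unfold mult; simpl; ring.
    - apply (is_RInt_plus (V := R_NormedModule));
        apply (is_RInt_scal (V := R_NormedModule));
        now apply (RInt_correct (V := R_CompleteNormedModule)). }
  rewrite <- hint.
  replace (1 + sin (theta - f a)) with (1 - sin (F a - theta)).
  2: { unfold F; rewrite clamp_id by (unfold cc; lra).
       replace (theta - f a) with (- (f a - theta)) by ring.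
       rewrite sin_neg; ring. }
  apply (RInt_cos_le (fun t => F t - theta) f');
    [exact hab | | | exact hmono | exact hlambda | exact hlow].
  - intros x; apply (continuous_minus (V := R_NormedModule) F (fun _ => theta));
      [apply hFc | apply continuous_const].
  - intros x hx; replace (f' x) with (f' x - 0) by ring.
    apply @is_derive_minus; [|apply @is_derive_const].
    now apply clamp_is_derive.
Qed.
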